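(* Let $G$ be a (finite, simple) plane graph with minimum degree five that contains no $\langle 5,6,6,5,\infty\rangle$-star and no $\langle 5,6,7,5,23\rangle$-star. Then $G$ has a minor $5$-star of weight at most $45$ and height at most $17$.
   Context: A plane graph is a graph embedded in the plane without edge crossings; $\deg(v)$ denotes the degree of $v$ in $G$. For integers (or $\infty$) $\kappa_1,\dots,\kappa_5$, a $\langle \kappa_1,\kappa_2,\kappa_3,\kappa_4,\kappa_5\rangle$-star in $G$ is a vertex $v$ of degree exactly $5$ together with its five neighbors $v_1,\dots,v_5$, listed in the cyclic order around $v$ given by the embedding (starting at some neighbor, in either orientation), such that $\deg(v_i)\le \kappa_i$ for $i=1,\dots,5$; the entry $\infty$ means no restriction. A minor $5$-star is a $5$-vertex together with its five neighbors. The weight of a subgraph $H$ is $\sum_{v\in V(H)}\deg_G(v)$, and its height is $\max_{v\in V(H)}\deg_G(v)$. *)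

(* Defs.v *)
From HB Require Import structures.
From mathcomp Require Import all_boot fingroup perm.

Set Implicit Arguments.
Unset Strict Implicit.
Unset Printing Implicit Defensive.

Record sgraph := SGraph {
  vertex :> finType;
  adj : rel vertex;
  adj_sym : symmetric adj;
  adj_irr : irreflexive adj
}.

Section Graph.
Variable G : sgraph.

Definition neighbors (v : G) : {set G} := [set w | adj v w].
Definition deg (v : G) : nat := #|neighbors v|.

Definition has_min_degree (d : nat) : Prop :=
  (forall v : G, d <= deg v) /\ (exists v : G, deg v = d).

(* A subgraph enters weight and height only through its vertex set. *)
Definition weight (H : {set G}) : nat := \sum_(u in H) deg u.
Definition height (H : {set G}) : nat := \max_(u in H) deg u.

Definition minor_star (v : G) : {set G} := v |: neighbors v.

End Graph.

(* Each edge vw gives two darts, (v, w) issuing from v and (w, v) from w. *)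
Definition dart (G : sgraph) : Type := {d : G * G | adj d.1 d.2}.
HB.instance Definition _ (G : sgraph) := SubFinite.on (dart G).

Section Darts.
Variable G : sgraph.

Definition src (d : dart G) : G := (val d).1.
Definition tgt (d : dart G) : G := (val d).2.

Lemma flip_subproof (d : dart G) : adj (tgt d) (src d).
Proof. by rewrite adj_sym; case: d. Qed.

Definition flip (d : dart G) : dart G :=
  exist (fun d : G * G => adj d.1 d.2) (tgt d, src d) (flip_subproof d).

End Darts.

Arguments src {G} d.
Arguments tgt {G} d.
Arguments flip {G} d.

Definition dart_link (G : sgraph) (r : dart G -> dart G) : rel (dart G) :=
  [rel d d' | (r d == d') || (flip d == d')].

(* An embedding is recorded by its rotation system: [rotation] sends each    *)
(* dart to the next one around its source, in a fixed orientation of the     *)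
(* plane, so that its cycles are the sets of darts issuing from a common     *)
(* vertex.  The boundary walks of the faces are then the orbits of           *)
(* [rotation \o flip].  The embedding is in the plane (equivalently, the     *)
(* sphere) when Euler's formula V - E + F = 2 holds for every connected      *)
(* component separately.  Since V - E + F <= 2 for each component of any     *)
(* rotation system, this amounts to the sum of these equalities, [euler].    *)
(* Isolated vertices carry no dart and do not contribute to [euler].         *)
Record plane_graph := PlaneGraph {
  graph :> sgraph;
  rotation : {perm dart graph};
  rotation_orbit : forall d d' : dart graph,
    fconnect rotation d d' = (src d == src d');
  euler : fcard rotation predT + fcard (rotation \o flip) predT
          = fcard (@flip graph) predT
            + 2 * n_comp (dart_link rotation) predT
}.

Section Star.
Variable G : plane_graph.

(* [s] lists the neighbors of [v] in cyclic order, from any starting         *)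
(* neighbor and in either orientation.                                       *)
Definition cyclic_neighbors (v : G) (s : seq G) : Prop :=
  exists2 d : dart G, src d = v
  & s = [seq tgt d' | d' <- orbit (rotation G) d]
    \/ s = [seq tgt d' | d' <- orbit (rotation G)^-1%g d].

(* [None] stands for the entry infinity. *)
Definition deg_le (w : G) (k : option nat) : bool :=
  if k is Some m then deg w <= m else true.

Definition has_star (k1 k2 k3 k4 k5 : option nat) : Prop :=
  exists2 v : G, deg v = 5
  & exists2 s : seq G, cyclic_neighbors v s
    & all2 deg_le s [:: k1; k2; k3; k4; k5].

End Star.

(* Main.v *)
Require Import Defs.
From Stdlib Require Import BinNat Nnat.
From mathcomp Require Import fingroup perm all_boot zify.

(** Discharging.  Give every vertex the charge [deg v - 6] and every face of
    length [r] the charge [2 r - 6]; by Euler's formula the total is negative.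
    A face of length at least 4 gives 1/2 to each of its corners.  A vertex [u]
    of degree [d >= 7] gives about [1 - 6/d] to each neighbor of degree 5, and
    the share of a neighbor of degree at least 6 goes by halves to the two
    neighbors next to it around [u] (Lebesgue).  If no minor 5-star is light,
    then the only 5-vertices left negative have all incident faces triangular
    and are surrounded cyclically by degrees [(5, 5, b, 5, x)] with
    [7 <= b <= 9] and [x >= 17], or by [(5, 6, 7, 5, x)] with [x >= 24].  The
    first kind is helped by its middle 5-neighbor, or by the 5-neighbor between
    this one and [x] when the latter sees two vertices of degree at least 17.
    The second kind is helped by its neighbor next to both the 7 and [x]; when
    that neighbor is itself of the second kind, the 7-vertex sees the
    consecutive degrees [(6, 5, 5, 6)] and is able to give more.

    The degrees matter only up to eleven classes, so the balance at a
    5-vertex is a finite computation. *)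

Set Implicit Arguments. Unset Strict Implicit. Unset Printing Implicit Defensive.

(** * Discharging rules *)

(* Class 0 stands for degree 5 (in minimum degree 5), class 1 for degree 6, and
   so on; class 10 stands for the degrees at least 24. *)
Definition thresholds := [:: 6; 7; 8; 9; 10; 12; 15; 17; 18; 24].
Definition dclass (n : nat) : nat := count (fun t => t <= n) thresholds.
(* The unbounded class 10 and class 9 (degrees 18 to 23) get the junk value 0. *)
Definition class_max (c : nat) : nat := nth 0 [:: 5; 6; 7; 8; 9; 11; 14; 16; 17] c.

(* The unit of charge is 1/420, and [base c] is [420 (1 - 6/d)] rounded down,
   for the least degree [d] of class [c].  Amounts are binary so that
   [stars_balanced] computes. *)
Definition base (c : nat) : N :=
  nth 0%num [:: 0; 0; 60; 105; 140; 168; 210; 252; 271; 280; 315]%num c.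
(** Half of [base], rounded down, from class 3 on; the entry for class 2 is junk, since [share]
    treats that class separately. *)
Definition side (c : nat) : N :=
  nth 0%num [:: 0; 0; 0; 52; 70; 84; 105; 126; 135; 140; 157]%num c.
(* A 7-vertex keeps half of the share coming from a neighbor of degree 6. *)
Definition share (c k : nat) : N :=
  if k == 0 then 0%num else if c == 2 then (if k == 1 then 15 else 30)%num else side c.
Definition donation (c l r : nat) : N :=
  if c <= 1 then 0%num else (base c + share c l + share c r)%num.

Definition dihedral (s : seq nat) : seq (seq nat) :=
  [seq rot i s | i <- iota 0 5] ++ [seq rot i (rev s) | i <- iota 0 5].

Definition contains (p : nat -> nat -> nat -> nat -> nat -> bool) (s : seq nat) : bool :=
  has (fun t => if t is [:: a; b; c; d; e] then p a b c d e else false) (dihedral s).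

(** In degrees, [e <= 9] means at most 23, [8 <= e] at least 17 and [10 <= e] at least 24. *)
Definition star5665 a b c d (e : nat) := [&& a == 0, b <= 1, c <= 1 & d == 0].
Definition star5675 a b c d e := [&& a == 0, b <= 1, c <= 2, d == 0 & e <= 9].
Definition tight567 a b c d e := [&& a == 0, b == 1, c == 2, d == 0 & 10 <= e].
Definition tight557 a b c d e := [&& a == 0, b == 0, c == 2, d == 0 & 8 <= e].
Definition tight558 a b c d e := [&& a == 0, b == 0, 3 <= c <= 4, d == 0 & 8 <= e].

(* What a tight star gets from its helper on top of the donations. *)
Definition bonus (s : seq nat) : N :=
  if contains tight567 s then 30%num else if contains tight557 s then 75%num
  else if contains tight558 s then 60%num else 0%num.

(* What a 5-vertex [u] gives to a 5-neighbor [v], one orientation at a time: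
   [k1], [k2] are the classes of the neighbors of [u] following [v], and [k4]
   that of the preceding one; [open] tells that [u] is on a nontriangular face,
   and [p4] that [u] is a center of type [(5, 6, 7, 5, x)].  In [a] and [w], [u]
   helps [(5, 5, b, 5, x)] from the middle and from between two large
   vertices; in [p], it helps [(5, 6, 7, 5, x)]. *)
Definition half_gift (open p4 : bool) (k1 k2 k4 : nat) : N :=
  let a := if [&& k4 == 0, 2 <= k1 <= 4 & (1 <= k2) || open]
           then if k1 == 2 then 75%num else 60%num else 0%num in
  let w := if [&& 8 <= k4, k1 == 0 & 8 <= k2]
           then if (10 <= k4) && (10 <= k2) then 75%num else 60%num else 0%num in
  let p := if [&& 10 <= k4, k1 == 2 & ~~ p4 || open] then 30%num else 0%num in
  (a + w + p)%num.

Definition gift (open p4 : bool) (k0 k1 k2 k3 k4 : nat) : N :=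
  if k0 == 0 then (half_gift open p4 k1 k2 k4 + half_gift open p4 k4 k3 k1)%num
  else 0%num.

(* [l2], [l], [r], [r2] are the classes of the neighbors around the receiver. *)
Definition supply (c l2 l r r2 : nat) : N :=
  if (c == 2) && ([&& l == 1, r == 0 & r2 == 1] || [&& r == 1, l == 0 & l2 == 1])
  then 105%num else donation c l r.

Definition gifts (open p4 : bool) (k0 k1 k2 k3 k4 : nat) : N :=
  (gift open p4 k0 k1 k2 k3 k4 + gift open p4 k1 k2 k3 k4 k0 +
   gift open p4 k2 k3 k4 k0 k1 + gift open p4 k3 k4 k0 k1 k2 +
   gift open p4 k4 k0 k1 k2 k3)%num.

Definition donations (k0 k1 k2 k3 k4 : nat) : N :=
  (donation k0 k1 k4 + donation k1 k2 k0 + donation k2 k3 k1 + donation k3 k4 k2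
   + donation k4 k0 k3)%num.

(** What the absence of a light star leaves visible on classes: a neighbor of degree at least 18, or
    a possible degree sum above 45 - 5. *)
Definition heavy (s : seq nat) := has (leq 9) s || (40 < sumn (map class_max s)).

(** A 5-vertex lacks 420. The first inequality serves when all its faces are triangles. Otherwise
    the second does: a longer face brings 210, and only the bases of the donations are
    guaranteed. *)
Definition balanced (k0 k1 k2 k3 k4 : nat) : bool :=
  let s := [:: k0; k1; k2; k3; k4] in
  if heavy s then if contains star5665 s || contains star5675 s then true else
  let p4 := contains tight567 s in
  N.leb (420 + gifts false p4 k0 k1 k2 k3 k4) (donations k0 k1 k2 k3 k4 + bonus s)
  && N.leb (420 + gifts true p4 k0 k1 k2 k3 k4)
       (210 + (base k0 + base k1 + base k2 + base k3 + base k4))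
  else true.

(** * Classes, rules and the finite check at 5-vertices *)

Lemma dclass_le c n : c < 10 -> (dclass n <= c) = (n < nth 0 thresholds c).
Proof.
rewrite /dclass /=.
do 10 (case: c => [|c] /=; first by lia).
by [].
Qed.

Lemma contains_rot1 p a b c d e :
  contains p [:: b; c; d; e; a] = contains p [:: a; b; c; d; e].
Proof.
rewrite /contains /= !orbF.
by do 10 (case: (p _ _ _ _ _) => /=; rewrite ?orbT //).
Qed.

Lemma contains_rev p a b c d e :
  contains p [:: a; e; d; c; b] = contains p [:: a; b; c; d; e].
Proof.
rewrite /contains /= !orbF.
by do 10 (case: (p _ _ _ _ _) => /=; rewrite ?orbT //).
Qed.

Lemma gift_rev open p4 a b c d e :
  gift open p4 a e d c b = gift open p4 a b c d e.
Proof. by rewrite /gift; case: eqP => // _; rewrite N.add_comm. Qed.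

Lemma donationC c l r : donation c l r = donation c r l.
Proof. by rewrite /donation; case: ifP => // _; lia. Qed.

(** Where the exceptional 105 applies, the donation is only 60 + 15 + 0; the excess 30 is the bonus
    of [tight567]. *)
Lemma donation_le_supply c l2 l r r2 :
  N.to_nat (donation c l r) <= N.to_nat (supply c l2 l r r2).
Proof.
rewrite /supply; case: ifP => // /andP[/eqP ->].
by case/orP=> /and3P[/eqP -> /eqP -> _]; rewrite /donation /share /=; lia.
Qed.

Lemma base_le_supply c l2 l r r2 :
  N.to_nat (base c) <= N.to_nat (supply c l2 l r r2).
Proof.
apply: leq_trans (donation_le_supply _ _ _ _ _).
rewrite /donation; case: ifP => [|_]; last by lia.
by case: c => [|[|c]].
Qed.

(** Read around the helper of a (5, 6, 7, 5, x) center, from that center on: if the helper is of the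
    same type, the 7 and the x fix the orientation. *)
Lemma contains_tight567 y z x : 10 <= x ->
  contains tight567 [:: 0; 2; y; z; x] -> y = 1 /\ z = 0.
Proof.
case: x => [|[|[|x]]] //= x10; rewrite /contains /= /tight567 /= !andbF /= !orbF.
by lia.
Qed.

Lemma half_gift_middle open p4 k1 k2 k4 : k4 = 0 -> 2 <= k1 <= 4 -> (1 <= k2) || open ->
  (if k1 == 2 then 75 else 60) <= N.to_nat (half_gift open p4 k1 k2 k4).
Proof. by move=> -> k1P k2P; rewrite /half_gift eqxx k1P k2P /=; case: ifP; lia. Qed.

Lemma half_gift_between open p4 k1 k2 k4 : k1 = 0 -> 8 <= k2 -> 8 <= k4 ->
  (if (10 <= k4) && (10 <= k2) then 75 else 60) <= N.to_nat (half_gift open p4 k1 k2 k4).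
Proof. by move=> -> k2P k4P; rewrite /half_gift k2P k4P /=; case: ifP; lia. Qed.

Lemma half_gift_next open p4 k1 k2 k4 : k1 = 2 -> 10 <= k4 -> ~~ p4 || open ->
  30 <= N.to_nat (half_gift open p4 k1 k2 k4).
Proof. by move=> -> k4P p4P; rewrite /half_gift k4P p4P /=; lia. Qed.

Lemma leb_addN a b c d : N.leb (N.add a b) (N.add c d) ->
  N.to_nat a + N.to_nat b <= N.to_nat c + N.to_nat d.
Proof. by move=> /N.leb_le; lia. Qed.

(** A star can be rotated so that a largest class comes first, hence the ranges bounded by [k0]. *)
Lemma stars_balanced : all (fun k0 => let r := iota 0 k0.+1 in
  all (fun k1 => all (fun k2 => all (fun k3 => all (balanced k0 k1 k2 k3) r) r) r) r)
  (iota 0 11).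
Proof. by vm_compute. Qed.

Lemma balanced_star k0 k1 k2 k3 k4 : k0 <= 10 ->
  k1 <= k0 -> k2 <= k0 -> k3 <= k0 -> k4 <= k0 -> balanced k0 k1 k2 k3 k4.
Proof.
move=> k0P k1P k2P k3P k4P; have := stars_balanced.
move=> /allP/(_ k0); rewrite mem_iota ltnS => /(_ k0P).
move=> /allP/(_ k1); rewrite mem_iota ltnS => /(_ k1P).
move=> /allP/(_ k2); rewrite mem_iota ltnS => /(_ k2P).
move=> /allP/(_ k3); rewrite mem_iota ltnS => /(_ k3P).
by move=> /allP/(_ k4); rewrite mem_iota ltnS => /(_ k4P).
Qed.

(** * Outflow of vertices of degree at least 7 *)

Lemma dclass_bounds n : 6 < n -> dclass n <= 10 /\ nth 0 thresholds (dclass n).-1 <= n.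
Proof.
move=> n7; have c10 : dclass n <= 10 by exact: count_size.
split=> //; have := @dclass_le (dclass n).-1 n; have := @dclass_le 0 n isT.
case: (dclass n) c10 => [|c] /= c10; first by rewrite leqnn => /esym; lia.
by move=> _ /(_ c10) dP; rewrite leqNgt -dP ltnn.
Qed.

(** A neighbor of degree 5 takes the base and passes on no share; any other one passes on at most
    half the base to each side. *)
Lemma share_le c k : 3 <= c <= 10 ->
  N.to_nat (base c) * (k == 0) + 2 * N.to_nat (share c k) <= N.to_nat (base c).
Proof.
rewrite /share; case: (k == 0) => [|/andP[c3 c10]]; first by rewrite muln1 addn0.
case: c c3 c10 => [|[|[|c]]] // _.
by do 8 (case: c => [|c] //).
Qed.

(** [base] is rounded down at the least degree of the class, and 1 - 6/d increases with d; 2520 is 6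
    * 420. *)
Lemma base_deg n : 7 < n ->
  3 <= dclass n <= 10 /\ n * N.to_nat (base (dclass n)) + 2520 <= 420 * n.
Proof.
move=> n8; have [] := dclass_bounds (ltnW n8).
have := @dclass_le 2 n isT; rewrite /= ltnNge n8 => /negbT; rewrite -ltnNge.
case: (dclass n) => [|[|[|c]]] // _.
by do 8 (case: c => [|c] /=; first by lia).
Qed.

Definition cell (l2 l k r r2 : nat) : N :=
  if k == 0 then supply 2 l2 l r r2 else 0%num.
Definition supplies7 (k0 k1 k2 k3 k4 k5 k6 : nat) : N :=
  (cell k5 k6 k0 k1 k2 + cell k6 k0 k1 k2 k3 + cell k0 k1 k2 k3 k4
   + cell k1 k2 k3 k4 k5 + cell k2 k3 k4 k5 k6 + cell k3 k4 k5 k6 k0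
   + cell k4 k5 k6 k0 k1)%num.

(** The rules of a 7-vertex only distinguish degrees 5, 6 and larger, which leaves 3^7 surroundings
    to check. *)
Lemma cell_minn l2 l k r r2 :
  cell l2 l k r r2 = cell (minn l2 2) (minn l 2) (minn k 2) (minn r 2) (minn r2 2).
Proof.
rewrite /cell /supply /donation /share.
have minE x : ((minn x 2 == 0) = (x == 0)) * ((minn x 2 == 1) = (x == 1)).
  by case: x => [|[|x]] //=; rewrite (minn_idPr _).
by rewrite !minE.
Qed.

(** No bound neighbor by neighbor works here because of the amount 105; it is paid from the half
    shares kept at neighbors of degree 6. *)
Lemma supplies7_le k0 k1 k2 k3 k4 k5 k6 :
  N.to_nat (supplies7 k0 k1 k2 k3 k4 k5 k6) <= 420.
Proof.
have : N.leb (supplies7 k0 k1 k2 k3 k4 k5 k6) 420; last by move=> /N.leb_le; lia.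
rewrite /supplies7 ![cell k0 _ _ _ _]cell_minn ![cell k1 _ _ _ _]cell_minn
  ![cell k2 _ _ _ _]cell_minn ![cell k3 _ _ _ _]cell_minn ![cell k4 _ _ _ _]cell_minn
  ![cell k5 _ _ _ _]cell_minn ![cell k6 _ _ _ _]cell_minn.
have : all (fun i => all (fun a0 => all (fun a1 => all (fun a2 => all (fun a3 => all
    (fun a4 => all (fun a5 => N.leb (supplies7 a0 a1 a2 a3 a4 a5 i) 420)
    (iota 0 3)) (iota 0 3)) (iota 0 3)) (iota 0 3)) (iota 0 3)) (iota 0 3)) (iota 0 3).
  by vm_compute.
have min3 k : minn k 2 \in iota 0 3 by rewrite mem_iota /= add0n ltnS geq_minr.
move=> /allP/(_ _ (min3 k6)) /allP/(_ _ (min3 k0)) /allP/(_ _ (min3 k1)).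
by move=> /allP/(_ _ (min3 k2)) /allP/(_ _ (min3 k3)) /allP/(_ _ (min3 k4))
  /allP/(_ _ (min3 k5)).
Qed.

(** Adds a local inequality over one representative per orbit; the orbits will be the vertices, then
    the faces. *)
Lemma orbit_sum_bound (T : finType) (f : T -> T) (K : nat) (a b : T -> nat) :
    injective f ->
    (forall x, K + \sum_(y <- orbit f x) a y <= \sum_(y <- orbit f x) b y) ->
  K * fcard f predT + \sum_x a x <= \sum_x b x.
Proof.
move=> f_inj leab.
have sumE c : \sum_x c x = \sum_(r in froots f) \sum_(y <- orbit f r) c y.
  rewrite (partition_big (froot f) (mem (froots f))) /=; last first.
    by move=> x _; apply: roots_root; apply: fconnect_sym.
  apply: eq_bigr => r /eqP rootr; rewrite big_uniq ?orbit_uniq //=.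
  apply: eq_bigl => y; rewrite -fconnect_orbit -(root_connect (fconnect_sym f_inj)).
  by rewrite rootr eq_sym.
have -> : K * fcard f predT = \sum_(r in froots f) K.
  rewrite sum_nat_const mulnC; congr (_ * _); apply: eq_card => x.
  by rewrite !inE andbT.
by rewrite !sumE -big_split leq_sum.
Qed.

(** * Rotation systems *)

Section Geometry.

Variable G : plane_graph.
Implicit Types (b : bool) (d e : dart G) (v : G).

(** The orientation is a boolean, so that mirror images are treated by one argument. *)
Definition turn b : {perm dart G} := if b then rotation G else (rotation G)^-1%g.
Arguments turn : simpl never.
Definition face_step d : dart G := rotation G (flip d).

Lemma flipK : involutive (@flip G).
Proof. by move=> d; apply: val_inj; case: d => [[x y] xy]. Qed.

Lemma src_flip d : src (flip d) = tgt d. Proof. by []. Qed.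
Lemma tgt_flip d : tgt (flip d) = src d. Proof. by []. Qed.

Lemma dart_inj d e : src d = src e -> tgt d = tgt e -> d = e.
Proof. by case: d e => [[x y] xy] [[x' y'] xy'] /= *; apply: val_inj; congr pair. Qed.

Lemma turnK b : cancel (turn b) (turn (~~ b)).
Proof. by case: b => d; rewrite /turn /= ?permK ?permKV. Qed.

Lemma turnKV b : cancel (turn (~~ b)) (turn b).
Proof. by case: b => d; rewrite /turn /= ?permK ?permKV. Qed.

Lemma fconnect_turn b d e : fconnect (turn b) d e = (src d == src e).
Proof.
case: b; first exact: rotation_orbit.
rewrite -(rotation_orbit d e) -(same_fconnect_finv (@perm_inj _ (rotation G))).
apply: eq_fconnect => x; apply: (@perm_inj _ (rotation G)).
by rewrite /turn permKV (f_finv (@perm_inj _ _)).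
Qed.

Lemma src_turn b d : src (turn b d) = src d.
Proof. by apply/esym/eqP; rewrite -(fconnect_turn b) fconnect1. Qed.

Lemma neighborsE v : neighbors v = tgt @: [set e | src e == v].
Proof.
apply/setP=> w; apply/idP/imsetP => [|[e]]; rewrite !inE.
  by move=> vw; exists (exist (fun d : G * G => adj d.1 d.2) (v, w) vw); rewrite ?inE.
by move=> /eqP <- ->; case: e.
Qed.

Lemma tgt_inj v : {in [set e : dart G | src e == v] &, injective tgt}.
Proof. by move=> d e; rewrite !inE => /eqP dv /eqP ev; apply: dart_inj; rewrite dv. Qed.

Lemma order_turn b d : order (turn b) d = deg (src d).
Proof.
rewrite /deg neighborsE card_in_imset; last exact: tgt_inj.
by apply: eq_card => e; rewrite !inE -[LHS]/(fconnect _ _ _) fconnect_turn eq_sym.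
Qed.

Lemma mem_orbit_turn b d e : (e \in orbit (turn b) d) = (src e == src d).
Proof. by rewrite -fconnect_orbit fconnect_turn eq_sym. Qed.

Lemma sum_orbit_turn b d (F : dart G -> nat) :
  \sum_(e <- orbit (turn b) d) F e = \sum_(e | src e == src d) F e.
Proof.
rewrite big_uniq ?orbit_uniq //=; apply: eq_bigl => e; exact: mem_orbit_turn.
Qed.

Lemma sum_neighbors v (F : G -> nat) :
  \sum_(w in neighbors v) F w = \sum_(e : dart G | src e == v) F (tgt e).
Proof.
rewrite neighborsE big_imset /=; last exact: tgt_inj.
by apply: eq_bigl => e; rewrite inE.
Qed.

Lemma sum_turn b v (F : dart G -> nat) :
  \sum_(e | src e == v) F (turn b e) = \sum_(e | src e == v) F e.
Proof.
rewrite [RHS](reindex_inj (@perm_inj _ (turn b))).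
by apply: eq_bigl => e; rewrite src_turn.
Qed.

(** * Triangles and face lengths *)

Definition triangulated v := [forall e, (src e == v) ==> (order face_step e == 3)].

Lemma face_step_inj : injective face_step.
Proof. by move=> d e /perm_inj /(can_inj flipK). Qed.

(** The face through [turn true d] has its corner at [src d] between [d] and [turn true d]; three
    steps close its boundary. *)
Lemma triangle d : order face_step (turn true d) = 3 ->
  turn false (flip d) = flip (turn true (flip (turn true d))).
Proof.
move=> ord3; have := iter_order face_step_inj (turn true d).
rewrite ord3 /= /face_step => /perm_inj /(canRL flipK) tri.
by rewrite -tri /turn permK.
Qed.

(** Consecutive neighbors of [v] are adjacent, and each comes next to [v] around the other. This
    carries the star of [v] over to the stars of its neighbors. *)
Lemma triangulatedP b v d : triangulated v -> src d = v ->
  tgt (turn (~~ b) (flip d)) = tgt (turn b d)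
  /\ tgt (turn b (flip (turn b d))) = tgt d.
Proof.
move=> /forallP tri dv.
have tri1 e : src e = v -> tgt (turn false (flip e)) = tgt (turn true e)
    /\ tgt (turn true (flip (turn true e))) = tgt e.
  move=> ev; have ord3 : order face_step (turn true e) = 3.
    by apply/eqP; apply: (implyP (tri _)); rewrite src_turn ev.
  split; first by rewrite triangle // tgt_flip src_turn.
  by have /(congr1 src) := triangle ord3; rewrite src_turn !src_flip => <-.
case: b => /=; first exact: tri1.
have := tri1 (turn false d); rewrite src_turn => /(_ dv).
by rewrite (turnK false) => -[-> ->].
Qed.

Hypothesis deg_ge5 : forall v, 5 <= deg v.

(** Length 1 would give a loop. With length 2, simplicity makes [flip d] a fixed point of the
    rotation, so its source has degree 1. *)
Lemma face_order d : 3 <= order face_step d.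
Proof.
have tgt_step e : src (face_step e) = tgt e by apply: (src_turn true).
have := order_gt0 face_step d; have := iter_order face_step_inj d.
case: (order _ _) => [|[|[|n]]] //= stepd _.
  have := tgt_step d; rewrite stepd => loop.
  by have := @adj_irr G (tgt d); rewrite -{1}loop; case: (d) => /= ? ->.
have flipd : face_step d = flip d.
  by apply: dart_inj; [apply: tgt_step | rewrite -tgt_step stepd].
have : fconnect (turn true) (flip d) =1 pred1 (flip d).
  move=> e; apply/idP/eqP => [|->]; last exact: connect0.
  by move=> /iter_findex <-; elim: (findex _ _ _) => //= n ->.
move=> /eq_card; rewrite card1 => ord1.
by have := deg_ge5 (src (flip d)); rewrite -(order_turn true) /order ord1.
Qed.

(** For length r this is an equality at r = 3, and amounts to 2520 <= 630 r for r >= 4. *)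
Lemma face_balance d :
  2520 + \sum_(e <- orbit face_step d) 210 * (order face_step e != 3)
  <= \sum_(e <- orbit face_step d) 840.
Proof.
have ordE e : e \in orbit face_step d -> order face_step e = order face_step d.
  rewrite -fconnect_orbit => de; apply: eq_card => x.
  by rewrite !inE -[LHS]/(fconnect _ _ _) -(same_connect (fconnect_sym face_step_inj) de).
under eq_big_seq => e /ordE -> do over.
rewrite !big_const_seq !count_predT !iter_addn_0 size_orbit.
by have := face_order d; case: eqP => [->|] /= *; lia.
Qed.

(** * Stars read from a dart *)

Definition tclass d : nat := dclass (deg (tgt d)).
Definition star b d : seq nat :=
  [:: tclass d; tclass (turn b d); tclass (turn b (turn b d));
      tclass (turn b (turn b (turn b d))); tclass (turn b (turn b (turn b (turn b d))))].

Lemma turn4 b d : deg (src d) = 5 ->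
  turn b (turn b (turn b (turn b d))) = turn (~~ b) d.
Proof.
move=> d5; apply: (@perm_inj _ (turn b)).
have := iter_order (@perm_inj _ (turn b)) d; rewrite order_turn d5 /= => ->.
by rewrite turnKV.
Qed.

Lemma turn3 b d : deg (src d) = 5 ->
  turn b (turn b (turn b d)) = turn (~~ b) (turn (~~ b) d).
Proof. by move=> d5; rewrite -(turn4 _ d5) turnK. Qed.

Lemma star_rot b d : deg (src d) = 5 -> star b (turn b d) = rot 1 (star b d).
Proof.
move=> d5; rewrite /star turn4 ?src_turn //.
by rewrite turnKV.
Qed.

Lemma star_flip b d : deg (src d) = 5 ->
  star (~~ b) d = rot 4 (rev (star b d)).
Proof. by move=> d5; rewrite /star turn4 // turn3 // !negbK turn4 // turn3 // ?negbK. Qed.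

(** Rotating the list changes the starting dart and reversing it changes the orientation, so a
    pattern found by [contains] is met at actual darts. *)
Lemma dihedral_star b d s : deg (src d) = 5 -> s \in dihedral (star b d) ->
  exists b' d', src d' = src d /\ s = star b' d'.
Proof.
move=> d5.
have rotE b' d' i : src d' = src d -> exists2 e, src e = src d & rot i (star b' d') = star b' e.
  move=> d'd; elim: i d' d'd => [|i IHi] d' d'd; first by exists d'; rewrite ?rot0.
  case: (ltnP i 5) => i5; last first.
    by exists d'; rewrite // rot_oversize //= ltnW.
  rewrite -addn1 rotD ?addn1 //.
  rewrite -star_rot ?d'd //; apply: IHi; by rewrite src_turn.
rewrite mem_cat => /orP[] /mapP[i _ ->].
  by have [e ed ->] := rotE b d i erefl; exists b, e.
have -> : rev (star b d) = rot 1 (star (~~ b) d).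
  by rewrite star_flip // /star.
rewrite -star_rot //; have [|e ed ->] := rotE (~~ b) (turn (~~ b) d) i.
  exact: src_turn.
by exists (~~ b), e.
Qed.

Lemma contains_star p b d : deg (src d) = 5 -> contains p (star b d) ->
  exists b' d', src d' = src d /\ p (tclass d') (tclass (turn b' d'))
    (tclass (turn b' (turn b' d'))) (tclass (turn b' (turn b' (turn b' d'))))
    (tclass (turn b' (turn b' (turn b' (turn b' d'))))).
Proof.
move=> d5 /hasP[s /(dihedral_star d5) [b' [d' [d'd ->]]] pd'].
by exists b', d'.
Qed.

(** * Transfers along darts *)

(* The charge sent by [src d] to [tgt d]. *)
Definition transfer d : nat := N.to_nat
  (if tclass d != 0 then 0%num
   else if dclass (deg (src d)) == 0 then
     gift (~~ triangulated (src d)) (contains tight567 (star true d))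
       (tclass d) (tclass (turn true d)) (tclass (turn true (turn true d)))
       (tclass (turn true (turn true (turn true d))))
       (tclass (turn true (turn true (turn true (turn true d)))))
   else supply (dclass (deg (src d)))
     (tclass (turn false (turn false d))) (tclass (turn false d))
     (tclass (turn true d)) (tclass (turn true (turn true d)))).

Lemma dclass0 v : (dclass (deg v) == 0) = (deg v == 5).
Proof. by have := deg_ge5 v; rewrite -leqn0 dclass_le //= => v5; lia. Qed.

Lemma contains_star_flip p b d : deg (src d) = 5 ->
  contains p (star b d) = contains p (star true d).
Proof.
case: b => // d5; rewrite (star_flip true) // /star /=.
by rewrite /rot /rev /=; exact: contains_rev.
Qed.

Lemma transferE b d : deg (src d) = 5 -> tclass d = 0 ->
  transfer d = N.to_nat
    (gift (~~ triangulated (src d)) (contains tight567 (star b d))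
       (tclass d) (tclass (turn b d)) (tclass (turn b (turn b d)))
       (tclass (turn b (turn b (turn b d))))
       (tclass (turn b (turn b (turn b (turn b d)))))).
Proof.
move=> d5 kd; rewrite /transfer kd /= d5 /= contains_star_flip //.
case: b => //; rewrite -[in RHS]gift_rev.
by rewrite !turn4 // !turn3.
Qed.

Lemma half_gift_le b d : deg (src d) = 5 -> tclass d = 0 ->
  N.to_nat (half_gift (~~ triangulated (src d)) (contains tight567 (star b d))
       (tclass (turn b d)) (tclass (turn b (turn b d))) (tclass (turn (~~ b) d)))
  <= transfer d.
Proof.
move=> d5 kd; rewrite (transferE b) // /gift kd /= turn4 //; lia.
Qed.

Lemma tclass_flip d : deg (src d) = 5 -> tclass (flip d) = 0.
Proof. by move=> d5; apply/eqP; rewrite dclass0; apply/eqP. Qed.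

(** By triangulation, the neighbors flanking [tgt d] in the star also flank [src d] around [tgt d],
    so the donor's shares can be read off the star. *)
Lemma donation_le_transfer b d : deg (src d) = 5 -> triangulated (src d) ->
  N.to_nat (donation (tclass d) (tclass (turn b d)) (tclass (turn (~~ b) d)))
  <= transfer (flip d).
Proof.
move=> d5 tri.
have -> : donation (tclass d) (tclass (turn b d)) (tclass (turn (~~ b) d))
        = donation (tclass d) (tclass (turn true d)) (tclass (turn false d)).
  by case: b => //=; rewrite donationC.
rewrite /transfer tclass_flip //= -/(tclass d); case: eqP => [->|_] //.
apply: leq_trans
  (donation_le_supply _ (tclass (turn false (turn false (flip d)))) _ _
    (tclass (turn true (turn true (flip d))))).
have [/= tgt1 _] := triangulatedP true tri erefl.
have [/= tgt2 _] := triangulatedP false tri erefl.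
by rewrite /tclass -tgt1 -tgt2.
Qed.

Lemma base_le_transfer d : deg (src d) = 5 ->
  N.to_nat (base (tclass d)) <= transfer (flip d).
Proof.
move=> d5; rewrite /transfer tclass_flip //= -/(tclass d).
by case: eqP => [->|_] //; exact: base_le_supply.
Qed.

(** * Use of the forbidden configurations *)

Hypothesis not_light : forall v, deg v = 5 ->
  ~ (weight (minor_star v) <= 45 /\ height (minor_star v) <= 17).
Hypothesis no_star1 : ~ has_star G (Some 5) (Some 6) (Some 6) (Some 5) None.
Hypothesis no_star2 : ~ has_star G (Some 5) (Some 6) (Some 7) (Some 5) (Some 23).

Lemma cyclic_neighbors_turn b d : deg (src d) = 5 ->
  cyclic_neighbors (src d) [seq tgt e | e <- traject (turn b) d 5].
Proof.
move=> d5; exists d => //.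
have -> : traject (turn b) d 5 = orbit (turn b) d by rewrite /orbit order_turn d5.
by case: b; [left | right].
Qed.

Lemma tclass_le c d : tclass d <= c -> c < 10 -> deg (tgt d) < nth 0 thresholds c.
Proof. by move=> + c10; rewrite /tclass dclass_le. Qed.

Lemma no_star5665 b d : deg (src d) = 5 ->
  star5665 (tclass d) (tclass (turn b d)) (tclass (turn b (turn b d)))
      (tclass (turn b (turn b (turn b d))))
      (tclass (turn b (turn b (turn b (turn b d))))) = false.
Proof.
move=> d5; apply/negP; rewrite /star5665 -!leqn0.
case/and4P=> /tclass_le k0 /tclass_le k1 /tclass_le k2 /tclass_le k3.
apply: no_star1; exists (src d) => //.
exists [seq tgt e | e <- traject (turn b) d 5]; first exact: cyclic_neighbors_turn.
by rewrite /= -ltnS k0 // -ltnS k1 // -ltnS k2 // -ltnS k3.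
Qed.

Lemma no_star5675 b d : deg (src d) = 5 ->
  star5675 (tclass d) (tclass (turn b d)) (tclass (turn b (turn b d)))
      (tclass (turn b (turn b (turn b d))))
      (tclass (turn b (turn b (turn b (turn b d))))) = false.
Proof.
move=> d5; apply/negP; rewrite /star5675 -!leqn0.
case/and5P=> /tclass_le k0 /tclass_le k1 /tclass_le k2 /tclass_le k3 /tclass_le k4.
apply: no_star2; exists (src d) => //.
exists [seq tgt e | e <- traject (turn b) d 5]; first exact: cyclic_neighbors_turn.
by rewrite /= -ltnS k0 // -ltnS k1 // -ltnS k2 // -ltnS k3 // -ltnS k4.
Qed.

Lemma no_excluded_star b d : deg (src d) = 5 ->
  contains star5665 (star b d) || contains star5675 (star b d) = false.
Proof.
move=> d5; apply/orP => -[] /(contains_star d5) [b' [d' [d'd]]].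
  by rewrite no_star5665 // d'd.
by rewrite no_star5675 // d'd.
Qed.

Lemma class_max_ge d : tclass d <= 8 -> deg (tgt d) <= class_max (tclass d).
Proof.
move=> d8; have := dclass_le (deg (tgt d)) (leq_ltn_trans d8 (isT : 8 < 10)).
rewrite leqnn -/(tclass d) => /esym.
by case: (tclass d) d8 => [|[|[|[|[|[|[|[|[|]]]]]]]]] //= _; lia.
Qed.

Lemma heavy_star b d : deg (src d) = 5 -> heavy (star b d).
Proof.
move=> d5; apply/negP=> /negP; rewrite /heavy negb_or -leqNgt => /andP[small light].
have sumE (F : dart G -> nat) : \sum_(e | src e == src d) F e
    = sumn [seq F e | e <- traject (turn b) d 5].
  rewrite -(sum_orbit_turn b) /orbit order_turn d5 sumnE big_map //.
have le8 e : src e = src d -> tclass e <= 8.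
  move=> ed; have : e \in traject (turn b) d 5.
    by have := mem_orbit_turn b d e; rewrite ed eqxx /orbit order_turn d5.
  move=> /(map_f tclass); rewrite -/(star b d) => et.
  by rewrite leqNgt; apply: contra small => e9; apply/hasP; exists (tclass e).
have vN : src d \notin neighbors (src d) by rewrite inE adj_irr.
apply: (not_light d5); split.
  rewrite /weight big_setU1 //= d5 sum_neighbors -[45]/(5 + 40) leq_add2l.
  apply: leq_trans light.
  have -> : map class_max (star b d) = [seq class_max (tclass e) | e <- traject (turn b) d 5] by [].
  by rewrite -sumE; apply: leq_sum => e /eqP ed; apply: class_max_ge; apply: le8.
apply/bigmax_leqP => w; rewrite !inE => /orP[/eqP -> |]; first by rewrite d5.
move=> vw; have : w \in neighbors (src d) by rewrite inE.
rewrite neighborsE => /imsetP[e]; rewrite inE => /eqP ed ->.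
by have := tclass_le (le8 e ed) isT.
Qed.

(* The helper is the vertex [a] behind [turn b d], or else the one behind [d],
   which is then consecutive to [a] in a triangle at [a] and sees two large
   vertices. *)
Lemma donor_55b b d : deg (src d) = 5 -> triangulated (src d) ->
    tclass d = 0 -> tclass (turn b d) = 0 -> 2 <= tclass (turn b (turn b d)) <= 4 ->
    tclass (turn b (turn b (turn b d))) = 0 -> 8 <= tclass (turn (~~ b) d) ->
  exists e, [/\ src e = src d, tclass e = 0 &
    (if tclass (turn b (turn b d)) == 2 then 75 else 60) <= transfer (flip e)].
Proof.
move=> d5 tri k0 k1 k2 k3 k4.
have src1 : src (turn b d) = src d by rewrite src_turn.
pose e := flip (turn b d).
have e5 : deg (src e) = 5 by apply/eqP; rewrite -dclass0; apply/eqP.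
have ke : tclass e = 0 by apply: tclass_flip; rewrite src1.
have eb : tgt (turn (~~ b) e) = tgt (turn b (turn b d)).
  by have [] := triangulatedP b tri src1.
have ev1 : tgt (turn b e) = tgt d by have [] := triangulatedP b tri erefl.
have gift_e := half_gift_le (~~ b) e5 ke.
(* Around the helper come, from [e] on: [src d], the vertex behind [turn b (turn b d)], some c, some
   p, and [tgt d]. It helps from the middle unless c has degree 5 and all its faces are
   triangles. *)
have [c_or_open|] := boolP ((1 <= tclass (turn (~~ b) (turn (~~ b) e))) || ~~ triangulated (src e)).
  exists (turn b d); split => //; apply: leq_trans gift_e.
  have -> : tclass (turn b (turn b d)) = tclass (turn (~~ b) e) by rewrite /tclass eb.
  apply: half_gift_middle; rewrite ?negbK //.
    by rewrite /tclass ev1.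
  by rewrite /tclass eb.
rewrite negb_or -eqn0Ngt negbK => /andP[/eqP c0 tri_e].
have ebk : tclass (turn (~~ b) e) = tclass (turn b (turn b d)) by rewrite /tclass eb.
have ev1k : tclass (turn b e) = 0 by rewrite /tclass ev1.
have p3 : turn (~~ b) (turn (~~ b) (turn (~~ b) e)) = turn b (turn b e).
  by rewrite turn3 // negbK.
have p4 : turn (~~ b) (turn (~~ b) (turn (~~ b) (turn (~~ b) e))) = turn b e.
  by rewrite turn4 // negbK.
(* Degrees 5, 5, 5 and at most 9 sum to at most 24, so the fifth must exceed 16. *)
have p8 : 8 <= tclass (turn b (turn b e)).
  have := heavy_star (~~ b) e5; rewrite /star p4 p3 ke ebk c0 ev1k /heavy /=.
  move: (tclass (turn b (turn b d))) k2 => [|[|[|[|[|]]]]] //= _;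
  by move: (tclass _) => [|[|[|[|[|[|[|[|]]]]]]]].
(* Degrees (5, 5, 7, 5, p) with p <= 23 form an excluded star; [x10] is the same at [src d]. *)
have p10 : tclass (turn b (turn b d)) = 2 -> 10 <= tclass (turn b (turn b e)).
  move=> kb; have := @no_star5675 (~~ b) (turn b e); rewrite src_turn => /(_ e5).
  rewrite turnK p3 ev1k ke ebk c0 kb /star5675 /=.
  by case: ltnP.
have x10 : tclass (turn b (turn b d)) = 2 -> 10 <= tclass (turn (~~ b) d).
  move=> kb; have := no_star5675 b d5.
  by rewrite turn4 // k0 k1 kb k3 /star5675 /=; case: ltnP.
pose f := flip d.
have f5 : deg (src f) = 5 by apply/eqP; rewrite -dclass0; apply/eqP.
have kf : tclass f = 0 by apply: tclass_flip.
have fx : tgt (turn b f) = tgt (turn (~~ b) d).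
  have [|_] := @triangulatedP b _ (turn (~~ b) d) tri; first by rewrite src_turn.
  by rewrite turnKV.
have fa : turn (~~ b) f = flip (turn b e).
  apply: dart_inj; first by rewrite src_turn !src_flip ev1.
  have [-> _] := triangulatedP b tri erefl.
  by rewrite tgt_flip src_turn.
have fp : tgt (turn (~~ b) (turn (~~ b) f)) = tgt (turn b (turn b e)).
  by rewrite fa; have [] := triangulatedP b tri_e (src_turn b e).
exists d; split => //; apply: leq_trans (half_gift_le (~~ b) f5 kf).
rewrite negbK; apply: (leq_trans _ (half_gift_between _ _ _ _ _)).
- rewrite /tclass fp fx -!/(tclass _); case: eqP => [kb|_]; last by case: ifP.
  by rewrite p10 ?x10.
- by rewrite fa /tclass tgt_flip src_turn -/(tclass _) k1.
- by rewrite /tclass fp.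
- by rewrite /tclass fx.
Qed.

(** The first case is help from the 5-neighbor between the 7 and x. In the second, that neighbor is
    itself such a center with triangular faces only, and the 7-vertex sees (6, 5, 5, 6). *)
Lemma donor_567 b d : deg (src d) = 5 -> triangulated (src d) ->
    tclass d = 0 -> tclass (turn b d) = 1 -> tclass (turn b (turn b d)) = 2 ->
    tclass (turn b (turn b (turn b d))) = 0 -> 10 <= tclass (turn (~~ b) d) ->
  30 <= transfer (flip (turn b (turn b (turn b d))))
  \/ transfer (flip (turn b (turn b d))) = 105.
Proof.
move=> d5 tri k0 k1 k2 k3 k4.
pose d2 := turn b (turn b d); pose d3 := turn b d2.
have src2 : src d2 = src d by rewrite !src_turn.
have src3 : src d3 = src d by rewrite !src_turn.
pose e := flip d3.
have e5 : deg (src e) = 5 by apply/eqP; rewrite -dclass0; apply/eqP.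
have ke : tclass e = 0 by apply: tclass_flip; rewrite src3.
have eb : tgt (turn b e) = tgt d2 by have [] := triangulatedP b tri src2.
have ex : tgt (turn (~~ b) e) = tgt (turn (~~ b) d).
  by have [-> _] := triangulatedP b tri src3; rewrite turn4.
have [p4open|] := boolP (~~ contains tight567 (star b e) || ~~ triangulated (src e)).
  left; apply: leq_trans (half_gift_le b e5 ke).
  by apply: half_gift_next => //; rewrite /tclass ?eb ?ex.
rewrite negb_or !negbK => /andP[p4 tri_e]; right.
have [y1 _] : tclass (turn b (turn b e)) = 1 /\ tclass (turn b (turn b (turn b e))) = 0.
  apply: (@contains_tight567 _ _ (tclass (turn (~~ b) d))) => //.
  move: p4; rewrite /star turn4 // ke.
  have -> : tclass (turn b e) = 2 by rewrite /tclass eb.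
  by rewrite /tclass ex.
pose g := flip d2.
have kg : tclass g = 0 by apply: tclass_flip; rewrite src2.
have ga : tclass (turn b g) = 1.
  have [_ ] := triangulatedP b tri (src_turn b d).
  by rewrite /tclass => ->.
have gv : tgt (turn (~~ b) g) = tgt d3 by have [] := triangulatedP b tri src2.
have gvk : tclass (turn (~~ b) g) = 0 by rewrite /tclass gv.
have ge : turn (~~ b) g = flip (turn b e).
  apply: dart_inj; first by rewrite src_turn !src_flip eb.
  by rewrite gv tgt_flip src_turn.
have gy : tclass (turn (~~ b) (turn (~~ b) g)) = 1.
  rewrite ge; have [tgty _] := triangulatedP b tri_e (src_turn b e).
  by rewrite /tclass tgty.
have gb : dclass (deg (src g)) = 2 by [].
rewrite -/d2 -/g /transfer kg /= gb /=; move: (g) ga gvk gy => h.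
by case: (b) => /= -> -> ->; rewrite /supply /= ?andbF ?orbT.
Qed.

(** * Balance at vertices *)

Lemma donation_bonus d : deg (src d) = 5 -> triangulated (src d) ->
  exists2 e, src e = src d &
    N.to_nat (donation (tclass e) (tclass (turn true e)) (tclass (turn false e)))
    + N.to_nat (bonus (star true d)) <= transfer (flip e).
Proof.
move=> d5 tri; rewrite /bonus.
have donation0 l r : donation 0 l r = 0%num by [].
case: ifP => [/(contains_star d5) [b [d' [d'd]]]|_].
  case/and5P=> /eqP k0 /eqP k1 /eqP k2 /eqP k3; rewrite turn4 ?d'd // => k4.
  have [||gift3|gift2] := @donor_567 b d' _ _ k0 k1 k2 k3 k4; rewrite ?d'd //.
    by exists (turn b (turn b (turn b d'))); rewrite ?src_turn // k3 donation0.
  exists (turn b (turn b d')); rewrite ?src_turn // gift2 k2.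
  (* Between degrees 6 and 5 the donation is 60 + 15 + 0, so 105 includes the bonus 30. *)
  have -> l r : donation 2 l r = (60 + share 2 l + share 2 r)%num by [].
  by case: (b) k1 k3 => k1 k3; rewrite ?(turnK true) ?(turnK false) k1 k3.
have donor amount b d' : src d' = src d ->
    tclass d' = 0 -> tclass (turn b d') = 0 -> 2 <= tclass (turn b (turn b d')) <= 4 ->
    tclass (turn b (turn b (turn b d'))) = 0 ->
    8 <= tclass (turn b (turn b (turn b (turn b d')))) ->
    N.to_nat amount = (if tclass (turn b (turn b d')) == 2 then 75 else 60) ->
    exists2 e, src e = src d &
      N.to_nat (donation (tclass e) (tclass (turn true e)) (tclass (turn false e)))
      + N.to_nat amount <= transfer (flip e).
  move=> d'd k0 k1 k2 k3 + ->; rewrite turn4 ?d'd // => k4.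
  have [||e [ed ke donorP]] := @donor_55b b d' _ _ k0 k1 k2 k3 k4; rewrite ?d'd //.
  by exists e; rewrite ?ed // ke donation0.
case: ifP => [/(contains_star d5) [b [d' [d'd]]]|_].
  case/and5P=> /eqP k0 /eqP k1 /eqP k2 /eqP k3 k4.
  by apply: (donor _ b d') => //; rewrite k2.
case: ifP => [/(contains_star d5) [b [d' [d'd]]]|_].
  case/and5P=> /eqP k0 /eqP k1 k2 /eqP k3 k4.
  apply: (donor _ b d') => //; first by case/andP: k2 => k2 ->; rewrite ltnW.
  by case: eqP k2 => [->|].
by exists d => //; rewrite addn0; exact: (donation_le_transfer true).
Qed.

Lemma sum5 d (F : dart G -> nat) : deg (src d) = 5 ->
  \sum_(e | src e == src d) F e =
  F d + F (turn true d) + F (turn true (turn true d))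
  + F (turn true (turn true (turn true d)))
  + F (turn true (turn true (turn true (turn true d)))).
Proof.
move=> d5; rewrite -(sum_orbit_turn true) /orbit order_turn d5 /=.
by rewrite !big_cons big_nil addn0 !addnA.
Qed.

Lemma sum_gifts d : deg (src d) = 5 ->
  \sum_(e | src e == src d) transfer e =
  N.to_nat (gifts (~~ triangulated (src d)) (contains tight567 (star true d))
    (tclass d) (tclass (turn true d)) (tclass (turn true (turn true d)))
    (tclass (turn true (turn true (turn true d))))
    (tclass (turn true (turn true (turn true (turn true d)))))).
Proof.
move=> d5; rewrite sum5 //.
have transferE5 e : deg (src e) = 5 -> transfer e = N.to_nat
    (gift (~~ triangulated (src e)) (contains tight567 (star true e))
       (tclass e) (tclass (turn true e)) (tclass (turn true (turn true e)))
       (tclass (turn true (turn true (turn true e))))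
       (tclass (turn true (turn true (turn true (turn true e)))))).
  by move=> e5; rewrite /transfer e5 /= /gift; case: eqP.
have star_turn e : deg (src e) = 5 ->
    contains tight567 (star true (turn true e)) = contains tight567 (star true e).
  by move=> e5; rewrite star_rot // [LHS]contains_rot1.
have turn5 : turn true (turn true (turn true (turn true (turn true d)))) = d.
  by rewrite turn4 ?src_turn // turnK.
have star_iter i : contains tight567 (star true (iter i (turn true) d))
    = contains tight567 (star true d).
  elim: i => // i IHi; rewrite iterS star_turn ?IHi //.
  by elim: i {IHi} => //= i IHi; rewrite src_turn.
rewrite !transferE5 ?src_turn // !turn5.
rewrite (star_iter 1) (star_iter 2) (star_iter 3) (star_iter 4).
by rewrite /gifts !N2Nat.inj_add.
Qed.

Lemma tclass_le10 d : tclass d <= 10.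
Proof. exact: count_size. Qed.

Lemma sum_income d : deg (src d) = 5 ->
  420 + \sum_(e | src e == src d) transfer e
  <= \sum_(e | src e == src d)
       (transfer (flip e) + 210 * (order face_step e != 3)).
Proof.
move=> d5.
(* Start at a largest class, as [balanced_star] requires. *)
have [d0 /eqP d0d d0max] : exists2 e, src e == src d &
    forall e', src e' == src d -> tclass e' <= tclass e.
  by case: (@arg_maxnP _ d (fun e => src e == src d) tclass) => // e ed emax; exists e.
rewrite -d0d in d5 d0max *.
rewrite sum_gifts // big_split /=.
have := @balanced_star (tclass d0) (tclass (turn true d0))
    (tclass (turn true (turn true d0))) (tclass (turn true (turn true (turn true d0))))
    (tclass (turn true (turn true (turn true (turn true d0))))) (tclass_le10 d0).
rewrite !d0max ?src_turn // => /(_ isT isT isT isT).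
rewrite /balanced -/(star true d0) heavy_star // no_excluded_star // => /andP[].
have [tri /leb_addN le_tri _|ntri _ /leb_addN le_open] := boolP (triangulated (src d0)).
  apply: (@leq_trans (\sum_(e | src e == src d0) transfer (flip e))); last exact: leq_addr.
  (* The neighbor behind [e1] pays the bonus on top of its donation; the other four pay at least
     their donations. *)
  have [e1 /eqP e1d bonus1] := donation_bonus d5 tri.
  have : N.to_nat (donations (tclass d0) (tclass (turn true d0))
      (tclass (turn true (turn true d0))) (tclass (turn true (turn true (turn true d0))))
      (tclass (turn true (turn true (turn true (turn true d0))))))
    = \sum_(e | src e == src d0)
        N.to_nat (donation (tclass e) (tclass (turn true e)) (tclass (turn false e))).
    have tK e : turn false (turn true e) = e by apply: (turnK true).
    have t5 : turn true (turn true (turn true (turn true (turn true d0)))) = d0.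
      by rewrite turn4 ?src_turn // turnK.
    have f0 : turn false d0 = turn true (turn true (turn true (turn true d0))).
      by rewrite turn4.
    by rewrite sum5 // !tK t5 f0 /donations !N2Nat.inj_add.
  rewrite (bigD1 e1) //= [in X in _ -> _ <= X](bigD1 e1) //=.
  set D := donations _ _ _ _ _ in le_tri *; set S := \sum_(e | _) N.to_nat _.
  have : S <= \sum_(e | (src e == src d0) && (e != e1)) transfer (flip e).
    apply: leq_sum => e /andP[/eqP ed _]; rewrite -ed in d5 tri.
    exact: (donation_le_transfer true).
  move=> leS sumD; apply: leq_trans le_tri _; rewrite sumD -/S addnAC.
  exact: leq_add.
have := sum5 (fun e => N.to_nat (base (tclass e))) d5.
have : \sum_(e | src e == src d0) N.to_nat (base (tclass e))
    <= \sum_(e | src e == src d0) transfer (flip e).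
  by apply: leq_sum => e /eqP ed; apply: base_le_transfer; rewrite ed.
have : 210 <= \sum_(e | src e == src d0) 210 * (order face_step e != 3).
  case/forallPn: ntri => e; rewrite negb_imply => /andP[ed e3].
  by rewrite (bigD1 e) //= e3 muln1 leq_addr.
move=> open_face le_base sumB; apply: leq_trans le_open _; rewrite addnC.
by apply: leq_add; last exact: open_face; rewrite !N2Nat.inj_add; rewrite sumB in le_base.
Qed.

Lemma sum7 d (F : dart G -> nat) : deg (src d) = 7 ->
  let t := turn true in
  \sum_(e | src e == src d) F e =
  F d + F (t d) + F (t (t d)) + F (t (t (t d))) + F (t (t (t (t d))))
  + F (t (t (t (t (t d))))) + F (t (t (t (t (t (t d)))))).
Proof.
move=> d7; rewrite -(sum_orbit_turn true) /orbit order_turn d7 /=.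
by rewrite !big_cons big_nil addn0 !addnA.
Qed.

Lemma transfer_cell d c : dclass (deg (src d)) = c.+1 ->
  transfer d = if tclass d != 0 then 0 else N.to_nat
    (supply c.+1 (tclass (turn false (turn false d))) (tclass (turn false d))
     (tclass (turn true d)) (tclass (turn true (turn true d)))).
Proof. by rewrite /transfer => ->; case: (tclass d != 0). Qed.

Lemma sum_transfer7 d : deg (src d) = 7 ->
  \sum_(e | src e == src d) transfer e <= 420.
Proof.
move=> d7; pose t := turn true.
have tK e : turn false (t e) = e by apply: (turnK true).
have t7 : t (t (t (t (t (t (t d)))))) = d.
  by have := iter_order (@perm_inj _ t) d; rewrite order_turn d7.
have f0 : turn false d = t (t (t (t (t (t d))))) by rewrite -{1}t7 tK.
have transfer7 e : src e = src d -> transfer e = N.to_nat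
    (cell (tclass (turn false (turn false e))) (tclass (turn false e)) (tclass e)
       (tclass (t e)) (tclass (t (t e)))).
  by move=> ed; rewrite (@transfer_cell _ 1) ?ed ?d7 // /cell; case: eqP.
rewrite sum7 // -/t !transfer7 ?src_turn // f0 !tK t7 f0.
apply: leq_trans (supplies7_le (tclass d) (tclass (t d)) (tclass (t (t d)))
  (tclass (t (t (t d)))) (tclass (t (t (t (t d))))) (tclass (t (t (t (t (t d))))))
  (tclass (t (t (t (t (t (t d)))))))).
by rewrite /supplies7 !N2Nat.inj_add.
Qed.

Lemma sum_transfer8 d : 7 < deg (src d) ->
  2520 + \sum_(e | src e == src d) transfer e <= 420 * deg (src d).
Proof.
move=> d8; have [] := base_deg d8; set c := dclass _ => c_bound.
apply: leq_trans; rewrite addnC leq_add2r.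
have c_eq e : src e = src d -> dclass (deg (src e)) = c.-1.+1.
  by move=> ->; rewrite -/c prednK //; case/andP: c_bound => /ltnW/ltnW.
have cE : c.-1.+1 = c by rewrite -(c_eq d).
apply: (@leq_trans (\sum_(e | src e == src d)
   (N.to_nat (base c) * (tclass e == 0) + N.to_nat (share c (tclass (turn false e)))
    + N.to_nat (share c (tclass (turn true e)))))).
  apply: leq_sum => e /eqP ed; rewrite (transfer_cell (c_eq e ed)) cE.
  case: eqP => //= _; rewrite /supply.
  have -> : (c == 2) = false by case/andP: c_bound; case: (c) => [|[|[|]]].
  rewrite /donation /=; case: ifP => // _.
  by rewrite muln1 !N2Nat.inj_add.
rewrite !big_split /=.
(* Shares are now counted at the neighbor they come from, not at the receiver, so that [share_le]
   applies termwise. *)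
rewrite (sum_turn false _ (fun e => N.to_nat (share c (tclass e)))).
rewrite (sum_turn true _ (fun e => N.to_nat (share c (tclass e)))).
rewrite -!big_split /=.
have -> : deg (src d) * N.to_nat (base c) = \sum_(e | src e == src d) N.to_nat (base c).
  rewrite -(sum_orbit_turn true) big_const_seq count_predT iter_addn_0.
  by rewrite size_orbit order_turn mulnC.
apply: leq_sum => e _; rewrite -addnA addnn -mul2n; exact: share_le.
Qed.

Lemma vertex_balance d :
  2520 + \sum_(e <- orbit (rotation G) d) transfer e
  <= \sum_(e <- orbit (rotation G) d)
       (420 + (transfer (flip e) + 210 * (order face_step e != 3))).
Proof.
rewrite -/(turn true) big_split /= big_const_seq count_predT iter_addn_0.
rewrite size_orbit order_turn !sum_orbit_turn.
have : 4 < deg (src d) by [].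
rewrite leq_eqVlt => /orP[/eqP d5|]; first by have := sum_income (esym d5); lia.
(* From degree 6 on, the received charge is bounded below by 0. *)
move=> d_gt5; rewrite -[leqLHS]addn0 leq_add //.
move: d_gt5; rewrite leq_eqVlt => /orP[/eqP d6|].
  rewrite -d6 big1 // => e /eqP ed.
  by rewrite (@transfer_cell e 0) ?ed -?d6 //; case: eqP.
rewrite leq_eqVlt => /orP[/eqP d7|/sum_transfer8 //].
by have := sum_transfer7 (esym d7); rewrite -d7; lia.
Qed.

(** * Contradiction with Euler's formula *)

Lemma card_dart : #|{: dart G}| = 2 * fcard (@flip G) predT.
Proof.
rewrite mulnC fcard_order_set //; first exact: can_inj flipK.
apply/subsetP => d _; rewrite inE.
have flip_neq : d != flip d.
  apply/eqP => /(congr1 src); rewrite src_flip => loop.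
  by have := adj_irr (src d); rewrite {2}loop; case: (d) => e /= ->.
rewrite (@order_cycle _ _ [:: d; flip d]) /= ?mem_head //.
  by rewrite !eqxx /= flipK eqxx.
by rewrite inE flip_neq.
Qed.

Lemma dart_link_sym : connect_sym (dart_link (rotation G)).
Proof.
have sub d e : dart_link (rotation G) d e -> connect (dart_link (rotation G)) e d.
  case/orP=> /eqP <-; last by apply: connect1; apply/orP; right; apply/eqP; exact: flipK.
  have : fconnect (rotation G) (rotation G d) d.
    by rewrite (fconnect_sym (@perm_inj _ _)) fconnect1.
  by apply: connect_sub => x y xy; apply: connect1; apply/orP; left.
have sym d e : connect (dart_link (rotation G)) d e -> connect (dart_link (rotation G)) e d.
  case/connectP => p; elim: p d => [|x p IHp] d /=; first by move=> _ ->.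
  by case/andP=> /sub dx /IHp + ex => /(_ ex) xe; apply: connect_trans xe dx.
by move=> d e; apply/idP/idP; apply: sym.
Qed.

(** The 2E darts count 420 each at vertices and 840 each at faces, so the balances add up to 2520 (V
    + F) <= 2520 E. By Euler's formula V + F exceeds E by twice the number of components, which is
    positive once a dart exists. *)
Lemma no_dart d : False.
Proof.
have comp : 0 < n_comp (dart_link (rotation G)) predT.
  apply/card_gt0P; exists (root (dart_link (rotation G)) d).
  by rewrite !inE roots_root //; exact: dart_link_sym.
have flip_sum : \sum_(e : dart G) transfer (flip e) = \sum_(e : dart G) transfer e.
  by rewrite [RHS](reindex_inj (can_inj flipK)).
pose T := \sum_(e : dart G) transfer e.
pose F := \sum_(e : dart G) 210 * (order face_step e != 3).
have vertices : 2520 * fcard (rotation G) predT + T <= #|{: dart G}| * 420 + (T + F).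
  have := orbit_sum_bound (@perm_inj _ (rotation G)) vertex_balance.
  by rewrite big_split /= big_split /= flip_sum sum_nat_const.
have faces : 2520 * fcard (rotation G \o flip) predT + F <= #|{: dart G}| * 840.
  by have := orbit_sum_bound face_step_inj face_balance; rewrite sum_nat_const.
rewrite card_dart in vertices faces.
have contradictory (v f e c t s : nat) : 2520 * v + t <= 2 * e * 420 + (t + s) ->
    2520 * f + s <= 2 * e * 840 -> v + f = e + 2 * c -> 0 < c -> False by lia.
exact: contradictory vertices faces (euler G) comp.
Qed.

End Geometry.

Theorem theorem14 (G : plane_graph) (hdeg : has_min_degree G 5)
  (hstar1 : ~ has_star G (Some 5) (Some 6) (Some 6) (Some 5) None)
  (hstar2 : ~ has_star G (Some 5) (Some 6) (Some 7) (Some 5) (Some 23)) :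
  exists v : G, [/\ deg v = 5, weight (minor_star v) <= 45
                  & height (minor_star v) <= 17].
Proof.
have [deg_ge5 [v v5]] := hdeg.
have [/existsP[u /and3P[/eqP]]|no_light] := boolP [exists u : G,
  [&& deg u == 5, weight (minor_star u) <= 45 & height (minor_star u) <= 17]].
  by exists u.
have : 0 < #|neighbors v| by rewrite -/(deg v) v5.
case/card_gt0P => w; rewrite inE => vw.
case: (@no_dart G deg_ge5 _ hstar1 hstar2 (exist _ (v, w) vw)) => u u5 [u45 u17].
by case/existsP: no_light; exists u; rewrite u5 eqxx u45.
Qed.
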